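(* Let $N\ge3$, $\lambda=\Lambda>0$, $p,q>0$, $pq>1$, and $\alpha=\frac{2(p+1)}{pq-1}$, $\beta=\frac{2(q+1)}{pq-1}$. If $\alpha+\beta\ge N-2$, then for any $R>0$ there is no radial positive solution of $$\lambda\Delta u+v^p=0,\qquad \lambda\Delta v+u^q=0,\qquad u,v>0\quad\text{in }\mathbb{R}^N\setminus \overline{B_R}$$ with the Dirichlet boundary condition $u=v=0$ on $\partial B_R$.
   Context: $B_R$ is the ball of radius $R$ centered at the origin in $\mathbb{R}^N$. Solutions are classical. For $\lambda=\Lambda$ the Pucci operators $\mathcal{M}^\pm_{\lambda,\Lambda}(D^2u)$ both equal $\lambda\Delta u$. *)

(* Defs.v *)
From mathcomp Require Import all_boot all_order all_algebra.
From mathcomp Require Import all_classical all_reals all_analysis.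
Import Order.TTheory GRing.Theory Num.Theory.
Import numFieldNormedType.Exports.

Set Implicit Arguments.
Unset Strict Implicit.
Unset Printing Implicit Defensive.

Local Open Scope classical_set_scope.
Local Open Scope ring_scope.

(* The library norm on 'rV[R]_N is the sup norm; it induces the usual topology
   on R^N, but balls and radial symmetry refer to the Euclidean norm. *)
Definition enorm (R : realType) (N : nat) (x : 'rV[R]_N) : R :=
  Num.sqrt (\sum_(i < N) x 0 i ^+ 2).

Definition closed_eball (R : realType) (N : nat) (r : R) : set 'rV[R]_N :=
  [set x | enorm x <= r].

Definition esphere (R : realType) (N : nat) (r : R) : set 'rV[R]_N :=
  [set x | enorm x = r].

Definition exterior (R : realType) (N : nat) (r : R) : set 'rV[R]_N :=
  ~` closed_eball r.

Definition partial (R : realType) (N : nat) (i : 'I_N) (f : 'rV[R]_N -> R)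
  : 'rV[R]_N -> R := fun x => 'D_(delta_mx 0 i) f x.

Definition has_partial (R : realType) (N : nat) (i : 'I_N)
  (f : 'rV[R]_N -> R) (x : 'rV[R]_N) : Prop := derivable f x (delta_mx 0 i).

Definition laplacian (R : realType) (N : nat) (f : 'rV[R]_N -> R)
  (x : 'rV[R]_N) : R := \sum_(i < N) partial i (partial i f) x.

(* Meant for open A, where continuity at every point of A in the ambient space
   is continuity on A; values of f outside A are then irrelevant. *)
Definition C0_on (R : realType) (N : nat) (A : set 'rV[R]_N)
  (f : 'rV[R]_N -> R) : Prop := forall x, A x -> {for x, continuous f}.

Definition C1_on (R : realType) (N : nat) (A : set 'rV[R]_N)
  (f : 'rV[R]_N -> R) : Prop :=
  C0_on A f /\
  forall i, (forall x, A x -> has_partial i f x) /\ C0_on A (partial i f).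

Definition C2_on (R : realType) (N : nat) (A : set 'rV[R]_N)
  (f : 'rV[R]_N -> R) : Prop :=
  C1_on A f /\ forall i, C1_on A (partial i f).

Definition radial_on (R : realType) (N : nat) (A : set 'rV[R]_N)
  (f : 'rV[R]_N -> R) : Prop :=
  forall x y, A x -> A y -> enorm x = enorm y -> f x = f y.

(* Classical regularity is C^2 inside the domain and continuity up to the
   boundary. *)
Definition classical_on (R : realType) (N : nat) (A : set 'rV[R]_N)
  (f : 'rV[R]_N -> R) : Prop :=
  C2_on A f /\ {within closure A, continuous f}.

(* u and v are total functions, but only their values on the closure of the
   exterior domain matter. *)
Record radial_positive_solution (R : realType) (N : nat) (lambda p q r : R)
    (u v : 'rV[R]_N -> R) : Prop := RadialPositiveSolution {
  rps_classical_u : classical_on (exterior r) u ;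
  rps_classical_v : classical_on (exterior r) v ;
  rps_radial_u : radial_on (exterior r) u ;
  rps_radial_v : radial_on (exterior r) v ;
  rps_eq_u : forall x, exterior r x -> lambda * laplacian u x + v x `^ p = 0 ;
  rps_eq_v : forall x, exterior r x -> lambda * laplacian v x + u x `^ q = 0 ;
  rps_pos : forall x, exterior r x -> 0 < u x /\ 0 < v x ;
  rps_dirichlet : forall x, esphere r x -> u x = 0 /\ v x = 0
}.

(* Main.v *)
Require Import Defs.
From mathcomp Require Import all_boot all_order all_algebra.
From mathcomp Require Import all_classical all_reals all_analysis.
From mathcomp Require Import ring lra.
Import Order.TTheory GRing.Theory Num.Theory.
Import numFieldNormedType.Exports.

Set Implicit Arguments.
Unset Strict Implicit.
Unset Printing Implicit Defensive.

Local Open Scope classical_set_scope.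
Local Open Scope ring_scope.

(** In the variable t = ln |x|, with nu = N - 2, a = - u' and b = - v', the
    profiles satisfy the autonomous system
      a' = w - nu a,  b' = z - nu b,  w = e^(2t) v^p / lambda,
      z = e^(2t) u^q / lambda.
    The Dirichlet condition forces a, b < 0 near the boundary, so that a
    Pohozaev energy with positive cross coefficients is positive there; it is
    nondecreasing because (p, q) is on or below the critical hyperbola.
    Eventually a and b are positive, w < N a <= N nu u and z < N b <= N nu v,
    which gives u = O(e^(- alpha t)) and v = O(e^(- beta t)) and bounds the
    energy by a multiple of e^((nu - alpha - beta) t).  This excludes
    alpha + beta > nu.  If alpha + beta = nu, the same estimates bound u and v
    from below, so that ln ((N a - w) / w) and ln ((N b - z) / z) are bounded
    above; but positivity of the energy makes their combination with weights
    p / (p + 1) and q / (q + 1) grow at least linearly. *)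

(** * Derivative rules with a prescribed value, and monotonicity on a half-line *)

Lemma is_derive_fM (R : realType) (f g : R -> R) (t df dg d : R) :
  is_derive t 1 f df -> is_derive t 1 g dg -> df * g t + f t * dg = d ->
  is_derive t 1 (fun s => f s * g s) d.
Proof.
move=> hf hg <-; apply: is_derive_eq (is_deriveM hf hg) _.
by rewrite /GRing.scale /= addrC [g t * df]mulrC.
Qed.

Lemma is_derive_fD (R : realType) (f g : R -> R) (t df dg d : R) :
  is_derive t 1 f df -> is_derive t 1 g dg -> df + dg = d ->
  is_derive t 1 (fun s => f s + g s) d.
Proof. by move=> hf hg <-; exact: is_deriveD hf hg. Qed.

Lemma is_derive_fZ (R : realType) (f : R -> R) (k t df d : R) :
  is_derive t 1 f df -> k * df = d -> is_derive t 1 (fun s => k * f s) d.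
Proof.
by move=> hf <-; apply: is_derive_fM (is_derive_cst k t 1) hf _; rewrite mul0r add0r.
Qed.

Lemma is_derive_expRZ (R : realType) (k t : R) :
  is_derive t 1 (fun s => expR (k * s)) (k * expR (k * t)).
Proof.
have h : is_derive t 1 (fun s : R => k * s) k.
  by apply: is_derive_fZ; rewrite ?mulr1.
by have := is_derive1_comp (is_derive_expR (k * t)) h; rewrite mulrC.
Qed.

Lemma is_derive_fln (R : realType) (f : R -> R) (t df d : R) :
  0 < f t -> is_derive t 1 f df -> df / f t = d ->
  is_derive t 1 (fun s => ln (f s)) d.
Proof.
move=> f0 hf <-; have := is_derive1_comp (is_derive1_ln f0) hf.
by rewrite mulrC.
Qed.

Lemma ray_MVT (R : realType) (f df : R -> R) (T s t : R) :
  (forall x, T < x -> is_derive x 1 f (df x)) -> T < s -> s < t ->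
  exists2 c, s < c < t & f t - f s = df c * (t - s).
Proof.
move=> hf Ts st; have [] := @MVT R f df s t st.
- by move=> x; rewrite in_itv /= => /andP[sx _]; apply: hf; apply: lt_trans sx.
- apply: derivable_within_continuous => x; rewrite in_itv /= => /andP[sx _].
  by have [] := hf x (lt_le_trans Ts sx).
- by move=> c; rewrite in_itv /= => hc ->; exists c.
Qed.

Lemma ray_ge0_ndecr (R : realType) (f df : R -> R) (T s t : R) :
  (forall x, T < x -> is_derive x 1 f (df x)) ->
  (forall x, s < x -> 0 <= df x) -> T < s -> s <= t -> f s <= f t.
Proof.
move=> hf h0 Ts; rewrite le_eqVlt => /orP[/eqP -> //|st].
have [c /andP[sc _] e] := ray_MVT hf Ts st.
by rewrite -subr_ge0 e mulr_ge0 ?h0// subr_ge0 ltW.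
Qed.

Lemma ray_derive_ge_unbounded (R : realType) (f df : R -> R) (T s d M : R) :
  (forall x, T < x -> is_derive x 1 f (df x)) -> T < s -> 0 < d ->
  (forall x, s < x -> d <= df x) -> exists2 t, s < t & M < f t.
Proof.
(* The step length [y] is chosen so that [d * y] exceeds [M - f s]; the maximum with 1 keeps it
   positive. *)
move=> hf Ts d0 hd; pose y := Num.max 1 ((M - f s) / d + 1).
have y1 : 1 <= y by rewrite le_max lexx.
have st : s < s + y by rewrite ltrDl; lra.
exists (s + y) => //.
have [c /andP[sc _]] := ray_MVT hf Ts st.
have -> : s + y - s = y by ring.
move=> e; have hM : M - f s < d * y.
  have : (M - f s) / d + 1 <= y by rewrite le_max lexx orbT.
  move=> h; rewrite mulrC -ltr_pdivrMr //; lra.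
have : d * y <= df c * y by rewrite ler_pM2r ?hd//; lra.
lra.
Qed.

(** * Sign and growth of solutions of the autonomous system *)

(* The equation for [u], whose source is [w], in the variable [t = ln |x|]; [a]
   is [- u'] and [nu] is [N - 2]. *)
Definition half_system (R : realType) (T nu : R) (u a w : R -> R) :=
  forall t, T < t -> [/\ 0 < u t, 0 < w t, is_derive t 1 u (- a t)
    & is_derive t 1 a (w t - nu * a t)].

(* [w = exp (m + 2 t) * v ^ p] with [v' = - b], recorded through the derivative
   and the logarithm of [w] so that no real power occurs below. *)
Definition power_source (R : realType) (T m p : R) (v b w : R -> R) :=
  forall t, T < t -> is_derive t 1 w (w t * (2 - p * b t / v t)) /\
    ln (w t) = m + 2 * t + p * ln (v t).

(** Since [u' = - a], the bound would make [- u] unbounded above, against [u > 0]. *)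
Lemma half_system_not_ge (R : realType) (T nu : R) (u a w : R -> R) (s d : R) :
  half_system T nu u a w -> T < s -> 0 < d ->
  ~ (forall t, s < t -> d <= a t).
Proof.
move=> hs Ts d0 h.
have hf x : T < x -> is_derive x 1 (fun t => (-1) * u t) (a x).
  by move=> /hs[_ _ hu _]; apply: is_derive_fZ hu _; ring.
have [t st] := ray_derive_ge_unbounded 0 hf Ts d0 h.
by have [+ _ _ _] := hs t (lt_trans Ts st); lra.
Qed.

(* [nu * u - a] is nonincreasing; were it negative, [u' = - a] would stay below a
   negative constant. *)
Lemma half_system_le (R : realType) (T nu : R) (u a w : R -> R) (s : R) :
  0 < nu -> half_system T nu u a w -> T < s -> a s <= nu * u s.
Proof.
move=> nu0 hs Ts; rewrite leNgt; apply/negP => hlt.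
have hf x : T < x -> is_derive x 1 (fun t => a t + (- nu) * u t) (w x).
  move=> /hs[_ _ hu ha]; apply: is_derive_fD ha (is_derive_fZ hu erefl) _; ring.
have d0 : 0 < a s - nu * u s by lra.
apply: (half_system_not_ge hs Ts d0) => t st.
have w0 x : s < x -> 0 <= w x.
  by move=> sx; have [_ /ltW] := hs x (lt_trans Ts sx).
have /= := ray_ge0_ndecr hf w0 Ts (ltW st).
have [u0 _ _ _] := hs t (lt_trans Ts st).
have := mulr_gt0 nu0 u0; lra.
Qed.

(** The function [a - nu * u] has derivative [w] and, by [half_system_le], never becomes
    positive. *)
Lemma half_system_source_not_ge (R : realType) (T nu : R) (u a w : R -> R)
    (s d : R) :
  0 < nu -> half_system T nu u a w -> T < s -> 0 < d ->
  ~ (forall t, s < t -> d <= w t).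
Proof.
move=> nu0 hs Ts d0 h.
have hf x : T < x -> is_derive x 1 (fun t => a t + (- nu) * u t) (w x).
  move=> /hs[_ _ hu ha]; apply: is_derive_fD ha (is_derive_fZ hu erefl) _; ring.
have [t st] := ray_derive_ge_unbounded 0 hf Ts d0 h.
have := half_system_le nu0 hs (lt_trans Ts st); lra.
Qed.

(** In the variable r = e^t the weighted quantity is - r^(N-1) u_r, whose derivative in [t] is
    [expR (nu * t) * w t > 0]. Hence positivity of [a] propagates forward and negativity
    backward. *)
Lemma half_system_weighted_ndecr (R : realType) (T nu : R) (u a w : R -> R)
    (s t : R) :
  half_system T nu u a w -> T < s -> s <= t ->
  expR (nu * s) * a s <= expR (nu * t) * a t.
Proof.
move=> hs Ts st.
have hf x : T < x -> is_derive x 1 (fun y => expR (nu * y) * a y)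
    (expR (nu * x) * w x).
  move=> /hs[_ _ _ ha].
  by apply: is_derive_fM (is_derive_expRZ nu x) ha _; ring.
apply: (ray_ge0_ndecr hf _ Ts st) => x sx.
have [_ w0 _ _] := hs x (lt_trans Ts sx).
by rewrite ltW// mulr_gt0// expR_gt0.
Qed.

Lemma half_system_gt0 (R : realType) (T nu : R) (u a w : R -> R) (s t : R) :
  half_system T nu u a w -> T < s -> s <= t -> 0 < a s -> 0 < a t.
Proof.
move=> hs Ts st as0; rewrite -(pmulr_rgt0 _ (expR_gt0 (nu * t))).
apply: lt_le_trans (half_system_weighted_ndecr hs Ts st).
by rewrite mulr_gt0 ?expR_gt0.
Qed.

Lemma half_system_lt0 (R : realType) (T nu : R) (u a w : R -> R) (s t : R) :
  half_system T nu u a w -> T < s -> s <= t -> a t < 0 -> a s < 0.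
Proof.
move=> hs Ts st at0; rewrite -(pmulr_rlt0 _ (expR_gt0 (nu * s))).
apply: le_lt_trans (half_system_weighted_ndecr hs Ts st) _.
by rewrite pmulr_rlt0 ?expR_gt0.
Qed.

(** If [a] were never positive, [u] would be nondecreasing, so [z], which grows like e^(2t) u^q,
    would stay above its value at [T + 1]; [half_system_source_not_ge] for [v] forbids this. *)
Lemma half_system_eventually_gt0 (R : realType) (T nu m q : R)
    (u a w v b z : R -> R) :
  0 < nu -> 0 < q -> half_system T nu u a w -> half_system T nu v b z ->
  power_source T m q u a z ->
  exists2 s, T < s & forall t, s <= t -> 0 < a t.
Proof.
move=> nu0 q0 hu hv hz; suff [s Ts as0] : exists2 s, T < s & 0 < a s.
  by exists s => // t st; exact: half_system_gt0 hu Ts st as0.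
apply: contrapT => nex.
have a0 t : T < t -> a t <= 0.
  by move=> Tt; rewrite leNgt; apply/negP => at0; apply: nex; exists t.
have hf x : T < x -> is_derive x 1 (fun t => (-1) * u t) (a x).
  by move=> /hu[_ _ h _]; apply: is_derive_fZ h _; ring.
have T1 : T < T + 1 by lra.
have [_ z0 _ _] := hv _ T1.
apply: (half_system_source_not_ge nu0 hv T1 z0) => t Tt.
have Tt' := lt_trans T1 Tt.
have [_ z1 _ _] := hv t Tt'.
have [u1 _ _ _] := hu t Tt'.
have [u0 _ _ _] := hu _ T1.
rewrite -ler_ln ?posrE//.
have [_ ->] := hz _ T1; have [_ ->] := hz t Tt'.
have [x -> x0] : exists2 x, ln (u t) = ln (u (T + 1)) + x & 0 <= x.
  exists (ln (u t) - ln (u (T + 1))); first by ring.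
  rewrite subr_ge0 ler_ln ?posrE//.
  have hf' x : T < x -> is_derive x 1 u (- a x) by move=> /hu[].
  apply: (ray_ge0_ndecr hf' _ T1 (ltW Tt)) => x Tx.
  by rewrite oppr_ge0 a0// (lt_trans T1 Tx).
have := mulr_ge0 (ltW q0) x0; lra.
Qed.

(* [e^(nu t) ((nu + 2) a - w)] has derivative [e^(nu t) p b w / v >= 0]; were it
   never positive, [a' >= 2 a] would keep [a] away from [0]. *)
Lemma half_system_gap (R : realType) (T nu m p : R) (u a w v b z : R -> R) :
  0 < nu -> 0 < p -> half_system T nu u a w -> half_system T nu v b z ->
  power_source T m p v b w ->
  (exists2 s, T < s & forall t, s <= t -> 0 < a t) ->
  (exists2 s, T < s & forall t, s <= t -> 0 < b t) ->
  exists2 s, T < s & forall t, s <= t -> w t < (nu + 2) * a t.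
Proof.
move=> nu0 p0 hu hv hw [s1 Ts1 a0] [s2 Ts2 b0].
pose s := Num.max s1 s2.
have Ts : T < s by rewrite lt_max Ts1.
have as0 t : s <= t -> 0 < a t by rewrite ge_max => /andP[/a0].
have bs0 t : s <= t -> 0 < b t by rewrite ge_max => /andP[_ /b0].
have hf x : T < x -> is_derive x 1
    (fun y => expR (nu * y) * ((nu + 2) * a y + (-1) * w y))
    (expR (nu * x) * (p * b x * w x / v x)).
  move=> Tx; have [_ _ _ ha] := hu x Tx; have [hw' _] := hw x Tx.
  have [v0 _ _ _] := hv x Tx.
  apply: is_derive_fM (is_derive_expRZ nu x)
    (is_derive_fD (is_derive_fZ ha erefl) (is_derive_fZ hw' erefl) erefl) _.
  by field; rewrite gt_eqF.
have df0 x : s < x -> 0 <= expR (nu * x) * (p * b x * w x / v x).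
  move=> sx; have [_ w0 _ _] := hu x (lt_trans Ts sx).
  have [v0 _ _ _] := hv x (lt_trans Ts sx).
  by rewrite mulr_ge0 ?expR_ge0// divr_ge0 ?(ltW v0)// !mulr_ge0// ltW// bs0// ltW.
suff [t st gt0] : exists2 t, s <= t & w t < (nu + 2) * a t.
  exists t; first exact: lt_le_trans st.
  move=> x tx; have Tt := lt_le_trans Ts st.
  have /= := ray_ge0_ndecr hf (fun y ty => df0 y (le_lt_trans st ty)) Tt tx.
  have : 0 < expR (nu * t) * ((nu + 2) * a t + -1 * w t).
    by rewrite mulr_gt0 ?expR_gt0//; lra.
  move=> /lt_le_trans h /h; rewrite pmulr_rgt0 ?expR_gt0//; lra.
apply: contrapT => nex.
have aw t : s <= t -> (nu + 2) * a t <= w t.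
  by move=> st; rewrite leNgt; apply/negP => h; apply: nex; exists t.
apply: (half_system_not_ge hu Ts (as0 s (lexx _))) => t st.
have ha x : T < x -> is_derive x 1 a (w x - nu * a x) by move=> /hu[].
apply: (ray_ge0_ndecr ha _ Ts (ltW st)) => x sx.
have := aw x (ltW sx); have := as0 x (ltW sx); lra.
Qed.

(** * The Pohozaev energy *)

Definition lane_emden_system (R : realType) (T nu m p q : R)
    (u a w v b z : R -> R) :=
  [/\ half_system T nu u a w, half_system T nu v b z,
      power_source T m p v b w & power_source T m q u a z].

(** With r = e^t this is the classical radial expression r^N (u_r v_r + v^(p+1) / (lambda (p+1)) +
    u^(q+1) / (lambda (q+1))) + r^(N-1) (A u_r v + B u v_r). *)
Definition pohozaev (R : realType) (nu p q A B : R) (u a w v b z : R -> R)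
    (t : R) : R :=
  expR (nu * t) * (a t * b t + v t * w t / (p + 1) + u t * z t / (q + 1)
    - A * (a t * v t) - B * (u t * b t)).

(** The divisors [p + 1] and [q + 1] cancel the terms in [b w] and [a z], and [A + B = nu] cancels
    those in [a b]. *)
Lemma pohozaev_derive (R : realType) (T nu m p q A B : R)
    (u a w v b z : R -> R) (t : R) :
  0 < p -> 0 < q -> A + B = nu ->
  lane_emden_system T nu m p q u a w v b z -> T < t ->
  is_derive t 1 (pohozaev nu p q A B u a w v b z)
    (expR (nu * t) * (((nu + 2) / (p + 1) - A) * (v t * w t)
                      + ((nu + 2) / (q + 1) - B) * (u t * z t))).
Proof.
move=> p0 q0 AB [hu hv hw hz] Tt.
have [u0 w0 du da] := hu t Tt; have [v0 z0 dv db] := hv t Tt.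
have [dw _] := hw t Tt; have [dz _] := hz t Tt.
have dab := is_derive_fM da db erefl.
have dvw := is_derive_fZ (k := (p + 1)^-1) (is_derive_fM dv dw erefl) erefl.
have duz := is_derive_fZ (k := (q + 1)^-1) (is_derive_fM du dz erefl) erefl.
have dav := is_derive_fZ (k := - A) (is_derive_fM da dv erefl) erefl.
have dub := is_derive_fZ (k := - B) (is_derive_fM du db erefl) erefl.
have -> : pohozaev nu p q A B u a w v b z = fun t => expR (nu * t) *
    (a t * b t + (p + 1)^-1 * (v t * w t) + (q + 1)^-1 * (u t * z t)
     + (- A) * (a t * v t) + (- B) * (u t * b t)).
  by apply/funext => x; rewrite /pohozaev; ring.
apply: is_derive_fM (is_derive_expRZ nu t) (is_derive_fD (is_derive_fD
  (is_derive_fD (is_derive_fD dab dvw erefl) duz erefl) dav erefl)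
  dub erefl) _.
have -> : A = nu - B by rewrite -AB; ring.
by field; rewrite !gt_eqF//; lra.
Qed.

(** The upper bounds on [A] and [B] make both coefficients in [pohozaev_derive] nonnegative, so the
    positive value at [s] serves as [c]. *)
Lemma pohozaev_bounded_below (R : realType) (T nu m p q A B : R)
    (u a w v b z : R -> R) (s : R) :
  0 < p -> 0 < q -> A + B = nu -> 0 <= A -> 0 <= B ->
  A <= (nu + 2) / (p + 1) -> B <= (nu + 2) / (q + 1) ->
  lane_emden_system T nu m p q u a w v b z -> T < s -> a s < 0 -> b s < 0 ->
  exists2 c, 0 < c & forall t, s <= t -> c <= pohozaev nu p q A B u a w v b z t.
Proof.
move=> p0 q0 AB A0 B0 hA hB hE Ts as0 bs0; have [hu hv _ _] := hE.
exists (pohozaev nu p q A B u a w v b z s).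
  have [u0 w0 _ _] := hu s Ts; have [v0 z0 _ _] := hv s Ts.
  rewrite mulr_gt0 ?expR_gt0//.
  have : 0 < a s * b s by rewrite nmulr_lgt0.
  have : 0 <= v s * w s / (p + 1) by rewrite divr_ge0 ?mulr_ge0 ?ltW//; lra.
  have : 0 <= u s * z s / (q + 1) by rewrite divr_ge0 ?mulr_ge0 ?ltW//; lra.
  have : A * (a s * v s) <= 0 by rewrite mulr_ge0_le0// nmulr_rle0// ltW.
  have : B * (u s * b s) <= 0 by rewrite mulr_ge0_le0// pmulr_rle0// ltW.
  lra.
move=> t st.
apply: (ray_ge0_ndecr (fun x => pohozaev_derive p0 q0 AB hE) _ Ts st) => x sx.
have [u0 w0 _ _] := hu x (lt_trans Ts sx).
have [v0 z0 _ _] := hv x (lt_trans Ts sx).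
rewrite mulr_ge0 ?expR_ge0// addr_ge0// mulr_ge0 ?subr_ge0//.
  by rewrite mulr_ge0 ?ltW.
by rewrite mulr_ge0 ?ltW.
Qed.

(** The cross terms are dropped by sign; each remaining term is at most a multiple of [u v], since
    [w < (nu + 2) * a <= (nu + 2) * nu * u] and likewise for [z]. *)
Lemma pohozaev_le (R : realType) (nu p q A B : R) (u a w v b z : R -> R)
    (t : R) :
  0 < nu -> 0 < p -> 0 < q -> 0 <= A -> 0 <= B -> 0 < u t -> 0 < v t ->
  0 < a t <= nu * u t -> 0 < b t <= nu * v t ->
  w t < (nu + 2) * a t -> z t < (nu + 2) * b t ->
  pohozaev nu p q A B u a w v b z t <=
  expR (nu * t) * ((nu * nu + (nu + 2) * nu / (p + 1) + (nu + 2) * nu / (q + 1))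
    * (u t * v t)).
Proof.
move=> nu0 p0 q0 A0 B0 u0 v0 /andP[a0 ha] /andP[b0 hb] hw hz.
rewrite /pohozaev ler_pM2l ?expR_gt0//.
have h1 : a t * b t <= (nu * u t) * (nu * v t) by rewrite ler_pM// ltW.
have h2 : v t * w t / (p + 1) <= v t * ((nu + 2) * (nu * u t)) / (p + 1).
  rewrite ler_pM2r ?invr_gt0; last by lra.
  rewrite ler_pM2l// (le_trans (ltW hw))// ler_pM2l//; lra.
have h3 : u t * z t / (q + 1) <= u t * ((nu + 2) * (nu * v t)) / (q + 1).
  rewrite ler_pM2r ?invr_gt0; last by lra.
  rewrite ler_pM2l// (le_trans (ltW hz))// ler_pM2l//; lra.
have h4 : 0 <= A * (a t * v t) by rewrite !mulr_ge0// ltW.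
have h5 : 0 <= B * (u t * b t) by rewrite !mulr_ge0// ltW.
have -> : (nu * nu + (nu + 2) * nu / (p + 1) + (nu + 2) * nu / (q + 1)) *
    (u t * v t) = (nu * u t) * (nu * v t)
    + v t * ((nu + 2) * (nu * u t)) / (p + 1)
    + u t * ((nu + 2) * (nu * v t)) / (q + 1) by ring.
lra.
Qed.

(** * Logarithmic estimates for decay and for the critical case *)

(* [x] and [y] stand for [ln u] and [ln v] at time [t]. *)
Lemma log_decay (R : realType) (p q alpha k t x y : R) :
  0 < p -> 1 < p * q -> alpha = 2 * (p + 1) / (p * q - 1) ->
  2 * t + p * y <= k + x -> 2 * t + q * x <= k + y ->
  x <= (p + 1) * k / (p * q - 1) - alpha * t.
Proof.
move=> p0 pq -> h1 h2.
(* Adding [p] times the second inequality to the first eliminates [y] and leaves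
   [(p * q - 1) * x <= (p + 1) * (k - 2 * t)]. *)
have h3 : p * (2 * t + q * x) <= p * (k + y) by rewrite ler_pM2l.
have -> : (p + 1) * k / (p * q - 1) - 2 * (p + 1) / (p * q - 1) * t =
  ((p + 1) * k - 2 * (p + 1) * t) / (p * q - 1) by ring.
rewrite ler_pdivlMr; last by lra.
have -> : x * (p * q - 1) = p * (q * x) - x by ring.
have -> : (p + 1) * k - 2 * (p + 1) * t = p * k + k - 2 * (p * t) - 2 * t by ring.
have -> : p * (q * x) = p * (2 * t + q * x) - 2 * (p * t) by ring.
have e : p * (k + y) = p * k + p * y by ring.
lra.
Qed.

(** For [g = (nu + 2) * a - w] one has [g' = p b w / v - nu g], hence [g' / g - w' / w = p b (g + w)
    / (v g) - (nu + 2)], where [g + w = (nu + 2) * a]. *)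
Lemma log_gap_derive (R : realType) (T nu m p : R) (u a w v b : R -> R) (t : R) :
  half_system T nu u a w -> power_source T m p v b w -> T < t ->
  0 < v t -> w t < (nu + 2) * a t ->
  is_derive t 1 (fun s => ln ((nu + 2) * a s + (-1) * w s) + (-1) * ln (w s))
    ((nu + 2) * (p * (a t * b t) / (v t * ((nu + 2) * a t - w t)) - 1)).
Proof.
move=> hu hw Tt v0 gap.
have [u0 w0 du da] := hu t Tt; have [dw _] := hw t Tt.
have dg := is_derive_fD (is_derive_fZ (k := nu + 2) da erefl)
  (is_derive_fZ (k := -1) dw erefl) erefl.
have g0 : 0 < (nu + 2) * a t + -1 * w t by lra.
have dlg := is_derive_fln
  (f := fun s => (nu + 2) * a s + (-1) * w s) g0 dg erefl.
have dlw := is_derive_fZ (k := -1) (is_derive_fln w0 dw erefl) erefl.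
apply: is_derive_fD dlg dlw _.
by field; rewrite !gt_eqF//; lra.
Qed.

(** The difference of the two sides is a square over [K * S]. The bound is linear in [S], so that
    the rates of the two equations can be added. *)
Lemma weighted_inv_ge (R : realType) (n K S : R) :
  0 < K -> 0 < S -> n - S / K <= n * (n * (K / S) - 1).
Proof.
move=> K0 S0; rewrite -subr_ge0.
have -> : n * (n * (K / S) - 1) - (n - S / K) = (n * K - S) ^+ 2 / (K * S).
  by field; rewrite !gt_eqF.
by rewrite divr_ge0 ?sqr_ge0// mulr_ge0 ?ltW.
Qed.

(* Here [g] and [h] stand for [(nu + 2) * a - w] and [(nu + 2) * b - z]; the
   last hypothesis says that the Pohozaev energy is positive. *)
Lemma weighted_rate_ge (R : realType) (nu p q a b u v g h : R) :
  0 < nu -> 0 < p -> 0 < q -> 0 < a -> 0 < b -> 0 < u -> 0 < v ->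
  0 < g -> 0 < h -> v * g / (p + 1) + u * h / (q + 1) < a * b ->
  (nu + 2) * ((p * q - 1) / ((p + 1) * (q + 1))) <=
  p / (p + 1) * ((nu + 2) * (p * (a * b) / (v * g) - 1)) +
  q / (q + 1) * ((nu + 2) * (q * (b * a) / (u * h) - 1)).
Proof.
move=> nu0 p0 q0 a0 b0 u0 v0 g0 h0 hK.
have K0 : 0 < a * b by rewrite mulr_gt0.
have p1 : 0 < p + 1 by lra.
have q1 : 0 < q + 1 by lra.
have S0 : 0 < v * g / (p + 1) by rewrite divr_gt0// mulr_gt0.
have T0 : 0 < u * h / (q + 1) by rewrite divr_gt0// mulr_gt0.
(* This form fits [weighted_inv_ge] with weights [p / (p + 1)] and [q / (q + 1)]; the two quotients
   [S / K] then sum to at most 1 by [hK]. *)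
have -> : p / (p + 1) * ((nu + 2) * (p * (a * b) / (v * g) - 1)) +
    q / (q + 1) * ((nu + 2) * (q * (b * a) / (u * h) - 1)) =
  (nu + 2) * (p / (p + 1) * (p / (p + 1) * (a * b / (v * g / (p + 1))) - 1) +
    q / (q + 1) * (q / (q + 1) * (a * b / (u * h / (q + 1))) - 1)).
  by field; rewrite !gt_eqF.
rewrite ler_pM2l; last by lra.
have H1 := weighted_inv_ge (p / (p + 1)) K0 S0.
have H2 := weighted_inv_ge (q / (q + 1)) K0 T0.
apply: le_trans (lerD H1 H2).
have -> : (p * q - 1) / ((p + 1) * (q + 1)) = p / (p + 1) + q / (q + 1) - 1.
  by field; rewrite !gt_eqF.
have : (v * g / (p + 1) + u * h / (q + 1)) / (a * b) <= 1.
  by rewrite ler_pdivrMr// mul1r ltW.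
rewrite mulrDl; lra.
Qed.

Lemma critical_log_gap_unbounded (R : realType) (T nu m p q : R)
    (u a w v b z : R -> R) (s M : R) :
  0 < nu -> 0 < p -> 0 < q -> 1 < p * q ->
  lane_emden_system T nu m p q u a w v b z -> T < s ->
  (forall t, s <= t -> [/\ 0 < a t, 0 < b t, w t < (nu + 2) * a t
     & z t < (nu + 2) * b t]) ->
  (forall t, s <= t -> 0 < pohozaev nu p q ((nu + 2) / (p + 1))
     ((nu + 2) / (q + 1)) u a w v b z t) ->
  exists2 t, s < t & M <
    p / (p + 1) * (ln ((nu + 2) * a t - w t) - ln (w t)) +
    q / (q + 1) * (ln ((nu + 2) * b t - z t) - ln (z t)).
Proof.
move=> nu0 p0 q0 pq [hu hv hw hz] Ts hpos hE.
have hf x : s < x -> is_derive x 1 (fun t =>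
    p / (p + 1) * (ln ((nu + 2) * a t + (-1) * w t) + (-1) * ln (w t)) +
    q / (q + 1) * (ln ((nu + 2) * b t + (-1) * z t) + (-1) * ln (z t)))
  (p / (p + 1) *
     ((nu + 2) * (p * (a x * b x) / (v x * ((nu + 2) * a x - w x)) - 1)) +
   q / (q + 1) *
     ((nu + 2) * (q * (b x * a x) / (u x * ((nu + 2) * b x - z x)) - 1))).
  move=> sx; have Tx := lt_trans Ts sx.
  have [a0 b0 hwa hzb] := hpos x (ltW sx).
  have [u0 _ _ _] := hu x Tx; have [v0 _ _ _] := hv x Tx.
  apply: is_derive_fD (is_derive_fZ (log_gap_derive hu hw Tx v0 hwa) erefl)
    (is_derive_fZ (log_gap_derive hv hz Tx u0 hzb) erefl) erefl.
have d0 : 0 < (nu + 2) * ((p * q - 1) / ((p + 1) * (q + 1))).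
  by rewrite mulr_gt0 ?divr_gt0 ?mulr_gt0//; lra.
(* The derivative formula [hf] holds only beyond [s], so the growth argument starts at [s + 1]. *)
have s1 : s < s + 1 by lra.
have [|t st Mt] := ray_derive_ge_unbounded M hf s1 d0.
  move=> x s1x; have sx := lt_trans s1 s1x; have Tx := lt_trans Ts sx.
  have [a0 b0 hwa hzb] := hpos x (ltW sx).
  have [u0 w0 _ _] := hu x Tx; have [v0 z0 _ _] := hv x Tx.
  apply: weighted_rate_ge => //; rewrite ?subr_gt0//.
  have := hE x (ltW sx); rewrite pmulr_rgt0 ?expR_gt0//.
  set X := (X in 0 < X -> _).
  (* For the critical [A] and [B], each cross term joins its source term to form a gap
     [(nu + 2) * a - w] or [(nu + 2) * b - z]. *)
  suff -> : X = a x * b x - (v x * ((nu + 2) * a x - w x) / (p + 1) +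
     u x * ((nu + 2) * b x - z x) / (q + 1)) by rewrite subr_gt0.
  by rewrite /X; ring.
exists t; first exact: lt_trans st.
by move: Mt; rewrite !mulN1r.
Qed.

(** Dropping [- w] bounds the gap by [(nu + 2) * nu * u], while a lower bound on [ln v] bounds
    [ln w] from below. *)
Lemma log_gap_le (R : realType) (nu m p c d a w u x y t : R) :
  0 < nu -> 0 < p -> 0 < u -> 0 < w -> w < (nu + 2) * a -> a <= nu * u ->
  ln u = x -> ln w = m + 2 * t + p * y -> x <= c -> d <= y ->
  ln ((nu + 2) * a - w) - ln w <= ln ((nu + 2) * nu) + c - m - 2 * t - p * d.
Proof.
move=> nu0 p0 u0 w0 gap ha hx -> hc hd.
have C0 : 0 < (nu + 2) * nu by rewrite mulr_gt0//; lra.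
have h1 : ln ((nu + 2) * a - w) <= ln ((nu + 2) * nu) + x.
  rewrite -hx -lnM ?posrE// ler_ln ?posrE 1?mulr_gt0// ?subr_gt0//.
  have : (nu + 2) * a <= (nu + 2) * (nu * u) by rewrite ler_pM2l//; lra.
  rewrite mulrA; lra.
have : p * d <= p * y by rewrite ler_pM2l.
lra.
Qed.

(** * Nonexistence for the autonomous system *)

Lemma lane_emden_system_nonexistence (R : realType) (T nu m p q alpha beta : R)
    (u a w v b z : R -> R) :
  0 < nu -> 0 < p -> 0 < q -> 1 < p * q ->
  alpha = 2 * (p + 1) / (p * q - 1) -> beta = 2 * (q + 1) / (p * q - 1) ->
  nu <= alpha + beta ->
  lane_emden_system T nu m p q u a w v b z ->
  ~ exists2 s, T < s & a s < 0 /\ b s < 0.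
Proof.
move=> nu0 p0 q0 pq ealpha ebeta hnu hE [s0 Ts0 [as0 bs0]].
have [hu hv hw hz] := hE.
have qp : 1 < q * p by rewrite mulrC.
have k0 : 0 < p * q - 1 by lra.
have pq2 : 0 < p + q + 2 by lra.
have eab : alpha + beta = 2 * (p + q + 2) / (p * q - 1).
  by rewrite ealpha ebeta; field; rewrite gt_eqF.
(* This splitting of [nu] makes [A * (p + 1) = B * (q + 1)], so that [hA] and [hB] both reduce to
   [hk], the critical hyperbola condition. *)
pose A := nu * (q + 1) / (p + q + 2).
pose B := nu * (p + 1) / (p + q + 2).
have AB : A + B = nu by rewrite /A /B; field; rewrite gt_eqF.
have A0 : 0 <= A by rewrite divr_ge0 ?mulr_ge0//; lra.
have B0 : 0 <= B by rewrite divr_ge0 ?mulr_ge0//; lra.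
have hk : nu * (p * q - 1) <= 2 * (p + q + 2).
  by move: hnu; rewrite eab ler_pdivlMr.
have hA : A <= (nu + 2) / (p + 1).
  rewrite /A ler_pdivrMr// mulrAC ler_pdivlMr; last by lra.
  have -> : nu * (q + 1) * (p + 1) = nu * (p * q - 1) + nu * (p + q + 2) by ring.
  rewrite mulrDl; lra.
have hB : B <= (nu + 2) / (q + 1).
  rewrite /B ler_pdivrMr// mulrAC ler_pdivlMr; last by lra.
  have -> : nu * (p + 1) * (q + 1) = nu * (p * q - 1) + nu * (p + q + 2) by ring.
  rewrite mulrDl; lra.
have [c c0 hc] := pohozaev_bounded_below p0 q0 AB A0 B0 hA hB hE Ts0 as0 bs0.
have ha := half_system_eventually_gt0 nu0 q0 hu hv hz.
have hb := half_system_eventually_gt0 nu0 p0 hv hu hw.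
have [s1 Ts1 hwa] := half_system_gap nu0 p0 hu hv hw ha hb.
have [s2 Ts2 hzb] := half_system_gap nu0 q0 hv hu hz hb ha.
have [s3 Ts3 a0] := ha; have [s4 Ts4 b0] := hb.
pose s := Num.max s0 (Num.max (Num.max s1 s2) (Num.max s3 s4)).
have Ts : T < s by rewrite lt_max Ts0.
have hs t : s <= t -> [/\ s0 <= t, 0 < a t, 0 < b t, w t < (nu + 2) * a t
     & z t < (nu + 2) * b t].
  by rewrite !ge_max => /and3P[? /andP[? ?] /andP[? ?]]; split; auto.
pose C := nu * nu + (nu + 2) * nu / (p + 1) + (nu + 2) * nu / (q + 1).
have n2 : 0 < (nu + 2) * nu by rewrite mulr_gt0//; lra.
have C0 : 0 < C by rewrite !addr_gt0 ?divr_gt0 ?mulr_gt0//; lra.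
(* [k] comes from the logarithm of [w <= (nu + 2) * nu * u], and [l] from that of
   [c <= C e^(nu t) u v]. *)
pose k := ln ((nu + 2) * nu) - m.
pose l := ln c - ln C.
have hlog t : s <= t -> [/\ ln (u t) <= (p + 1) * k / (p * q - 1) - alpha * t,
    ln (v t) <= (q + 1) * k / (p * q - 1) - beta * t &
    l <= nu * t + ln (u t) + ln (v t)].
  move=> st; have Tt := lt_le_trans Ts st; have [s0t at0 bt0 hwt hzt] := hs t st.
  have [u0 w0 _ _] := hu t Tt; have [v0 z0 _ _] := hv t Tt.
  have au := half_system_le nu0 hu Tt; have bv := half_system_le nu0 hv Tt.
  have hx : 2 * t + p * ln (v t) <= k + ln (u t).
    suff : ln (w t) <= ln ((nu + 2) * nu) + ln (u t).
      by have [_ ->] := hw t Tt; rewrite /k; lra.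
    rewrite -lnM ?posrE// ler_ln ?posrE 1?mulr_gt0// -mulrA (le_trans (ltW hwt))//.
    by rewrite ler_pM2l//; lra.
  have hy : 2 * t + q * ln (u t) <= k + ln (v t).
    suff : ln (z t) <= ln ((nu + 2) * nu) + ln (v t).
      by have [_ ->] := hz t Tt; rewrite /k; lra.
    rewrite -lnM ?posrE// ler_ln ?posrE 1?mulr_gt0// -mulrA (le_trans (ltW hzt))//.
    by rewrite ler_pM2l//; lra.
  split.
  - exact: log_decay p0 pq ealpha hx hy.
  - rewrite [p * q]mulrC; apply: log_decay q0 qp _ hy hx.
    by rewrite [q * p]mulrC.
  - have h := le_trans (hc t s0t) (@pohozaev_le R nu p q A B u a w v b z t
      nu0 p0 q0 A0 B0 u0 v0 (introT andP (conj at0 au))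
      (introT andP (conj bt0 bv)) hwt hzt).
    move: h; rewrite -/C -ler_ln ?posrE ?mulr_gt0 ?expR_gt0//.
    by rewrite !lnM ?posrE ?mulr_gt0 ?expR_gt0// expRK /l; lra.
(* Summing the bounds of [hlog] gives [l <= c1 - d * t], which fails for large [t] if [d > 0]. *)
have enu : nu = alpha + beta.
  apply/eqP; rewrite eq_le hnu leNgt; apply/negP => lt_nu.
  pose c1 := (p + 1) * k / (p * q - 1) + (q + 1) * k / (p * q - 1).
  pose d := alpha + beta - nu.
  have d0 : 0 < d by rewrite /d; lra.
  pose t := Num.max s ((c1 - l) / d + 1).
  have st : s <= t by rewrite le_max lexx.
  have [h1 h2 h3] := hlog t st.
  have : (c1 - l) / d < t by rewrite lt_max ltrDl ltr01 orbT.
  rewrite ltr_pdivrMr// /d /c1; lra.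
(* On the critical hyperbola both coefficients in [pohozaev_derive] vanish. *)
have eA : A = (nu + 2) / (p + 1).
  by rewrite /A enu eab; field; rewrite !gt_eqF//; lra.
have eB : B = (nu + 2) / (q + 1).
  by rewrite /B enu eab; field; rewrite !gt_eqF//; lra.
pose cu := (p + 1) * k / (p * q - 1).
pose cv := (q + 1) * k / (p * q - 1).
pose Lu := ln ((nu + 2) * nu) + cu - m - p * (l - cu).
pose Lv := ln ((nu + 2) * nu) + cv - m - q * (l - cv).
have [||t st] := @critical_log_gap_unbounded _ _ _ _ _ _ _ _ _ _ _ _ s
  (p / (p + 1) * Lu + q / (q + 1) * Lv) nu0 p0 q0 pq hE Ts.
- by move=> t /hs[].
- move=> t /hs[s0t _ _ _ _]; rewrite -eA -eB.
  exact: lt_le_trans c0 (hc t s0t).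
apply/negP; rewrite -leNgt; have Tt := lt_trans Ts st.
have [h1 h2 h3] := hlog t (ltW st); have [_ _ _ hwt hzt] := hs t (ltW st).
have [u0 w0 _ _] := hu t Tt; have [v0 z0 _ _] := hv t Tt.
have au := half_system_le nu0 hu Tt; have bv := half_system_le nu0 hv Tt.
have [_ ew] := hw t Tt; have [_ ez] := hz t Tt.
(* The lower bound on [u v] and the decay of one factor bound the other from below at its own decay
   rate. *)
have dv : l - cu - beta * t <= ln (v t) by move: h1 h3; rewrite -/cu enu; lra.
have du : l - cv - alpha * t <= ln (u t) by move: h2 h3; rewrite -/cv enu; lra.
(* These identities cancel all terms in [t] in the bounds of [log_gap_le], leaving the constants
   [Lu] and [Lv]. *)
have pbeta : p * beta = alpha + 2 by rewrite ealpha ebeta; field; rewrite gt_eqF.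
have qalpha : q * alpha = beta + 2 by rewrite ealpha ebeta; field; rewrite gt_eqF.
have gu := log_gap_le nu0 p0 u0 w0 hwt au erefl ew h1 dv.
have gv := log_gap_le nu0 q0 v0 z0 hzt bv erefl ez h2 du.
apply: lerD; rewrite ler_pM2l ?divr_gt0//; try lra.
- apply: le_trans gu _; rewrite -/cu /Lu.
  have -> : p * (l - cu - beta * t) = p * (l - cu) - (p * beta) * t by ring.
  rewrite pbeta; lra.
- apply: le_trans gv _; rewrite -/cv /Lv.
  have -> : q * (l - cv - alpha * t) = q * (l - cv) - (q * alpha) * t by ring.
  rewrite qalpha; lra.
Qed.

(** * Radial functions along a coordinate ray *)

Lemma is_derive_line (R : realType) (V : normedModType R) (f : V -> R)
    (x y v : V) (s : R) :
  y = x + s *: v -> derivable f y v ->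
  is_derive s 1 (fun t : R => f (x + t *: v)) ('D_v f y).
Proof.
move=> ->; have e : (fun h => h^-1 *: ((f \o shift (x + s *: v)) (h *: v)
    - f (x + s *: v))) =
  (fun h : R => h^-1 *: (((fun t : R => f (x + t *: v)) \o shift s) (h *: (1 : R))
    - f (x + s *: v))).
  by apply/funext => h; rewrite /= scalerDl /GRing.scale /= mulr1 addrCA.
by rewrite /derivable /derive e => h; apply: DeriveDef.
Qed.

Lemma enorm_ray (R : realType) (N : nat) (i : 'I_N) (s : R) :
  enorm (s *: delta_mx 0 i : 'rV[R]_N) = `|s|.
Proof.
rewrite /enorm (bigD1 i)//= big1 => [|k ki]; last first.
  by rewrite !mxE eqxx (negbTE ki) mulr0 expr0n.
by rewrite !mxE !eqxx mulr1 addr0 sqrtr_sqr.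
Qed.

Lemma enorm_plane (R : realType) (N : nat) (i j : 'I_N) (s t : R) : i != j ->
  enorm (s *: delta_mx 0 i + t *: delta_mx 0 j : 'rV[R]_N) =
  Num.sqrt (s ^+ 2 + t ^+ 2).
Proof.
move=> ij; rewrite /enorm (bigD1 i)//= (bigD1 j)/=; last by rewrite eq_sym.
rewrite big1 => [|k /andP[ki kj]]; last first.
  by rewrite !mxE eqxx (negbTE ki) (negbTE kj) !mulr0 addr0 expr0n.
rewrite !mxE !eqxx (negbTE ij) eq_sym (negbTE ij).
by rewrite !mulr1 !mulr0 !addr0 add0r.
Qed.

Lemma exterior_ray (R : realType) (N : nat) (i : 'I_N) (r s : R) :
  0 < r -> r < s -> exterior r (s *: delta_mx 0 i : 'rV[R]_N).
Proof.
move=> r0 rs; rewrite /exterior /closed_eball /= enorm_ray.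
by apply/negP; rewrite -ltNge gtr0_norm ?(lt_trans r0).
Qed.

Section radial.
Variables (R : realType) (N : nat) (f : 'rV[R]_N -> R) (i : 'I_N) (r : R).
Hypotheses (r0 : 0 < r) (f2 : C2_on (exterior r) f).
Hypothesis fr : radial_on (exterior r) f.

Lemma is_derive_ray (s : R) : r < s ->
  is_derive s 1 (fun t => f (t *: delta_mx 0 i))
    (partial i f (s *: delta_mx 0 i)).
Proof.
move=> rs; have [[_ /(_ i)[h _]] _] := f2.
have := h (s *: delta_mx 0 i) (exterior_ray r0 rs).
move=> /(is_derive_line (s := s) (x := 0)); rewrite add0r => /(_ erefl).
by under eq_fun do rewrite add0r.
Qed.

Lemma is_derive_partial_ray (s : R) : r < s ->
  is_derive s 1 (fun t => partial i f (t *: delta_mx 0 i))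
    (partial i (partial i f) (s *: delta_mx 0 i)).
Proof.
move=> rs; have [_ /(_ i)[_ /(_ i)[h _]]] := f2.
have := h (s *: delta_mx 0 i) (exterior_ray r0 rs).
move=> /(is_derive_line (s := s) (x := 0)); rewrite add0r => /(_ erefl).
by under eq_fun do rewrite add0r.
Qed.

(* Radial symmetry turns [f] along the line through [s *: e_i] in direction
   [e_j] into [t |-> F (sqrt (s ^ 2 + t ^ 2))], with [F] the profile of [f]. *)
Lemma partial_orthogonal (s : R) (j : 'I_N) : i != j -> r < s ->
  partial j (partial j f) (s *: delta_mx 0 i) =
  partial i f (s *: delta_mx 0 i) / s.
Proof.
move=> ij rs; have s0 : 0 < s by apply: lt_trans rs.
pose e k : 'rV[R]_N := delta_mx 0 k.
pose n (t : R) : R := Num.sqrt (s ^+ 2 + t ^+ 2).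
have n0 : n 0 = s by rewrite /n expr0n addr0 sqrtr_sqr gtr0_norm.
have p0 t : 0 < s ^+ 2 + t ^+ 2.
  by rewrite ltr_wpDr ?sqr_ge0// exprn_gt0.
have sn t : s <= n t.
  rewrite -[leLHS]gtr0_norm// -sqrtr_sqr ler_wsqrtr// lerDl sqr_ge0//.
have rn t : r < n t by apply: lt_le_trans (sn t).
have nt0 t : 0 < n t by apply: lt_trans (rn t).
have ext t : exterior r (s *: e i + t *: e j).
  rewrite /exterior /closed_eball /= enorm_plane//.
  by apply/negP; rewrite -ltNge; exact: rn.
have dn (t : R) : is_derive t 1 n (t / n t).
  have h : is_derive t 1 (fun x => s ^+ 2 + x ^+ 2) (2 * t).
    apply: is_derive_fD (is_derive_cst _ _ _)
      (is_derive_fM (is_derive_id t 1) (is_derive_id t 1) erefl) _.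
    by rewrite /=; ring.
  have := is_derive1_comp
    (g := fun x => s ^+ 2 + x ^+ 2) (is_derive1_sqrt (p0 t)) h.
  move=> d; apply: is_derive_eq d _; rewrite -/(n t); field.
  by rewrite gt_eqF.
have dF (t : R) : is_derive t 1 (fun x => f (s *: e i + x *: e j))
    (partial i f (n t *: e i) * (t / n t)).
  have -> : (fun x => f (s *: e i + x *: e j)) = (fun x => f (x *: e i)) \o n.
    apply/funext => x /=; apply: fr => //; first exact: exterior_ray.
    by rewrite enorm_plane// enorm_ray gtr0_norm.
  exact: (is_derive1_comp (g := n) (is_derive_ray (rn t)) (dn t)).
have [[_ /(_ j)[h1 _]] /(_ j)[_ /(_ j)[h2 _]]] := f2.
(* The first derivative is identified on the whole line so that it can be differentiated again at
   [t = 0]. *)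
have pF : (fun t => partial j f (s *: e i + t *: e j)) =
    (fun t => partial i f (n t *: e i) * (t / n t)).
  apply/funext => t; have [_ <-] := dF t.
  by have [_ ->] := is_derive_line erefl (h1 _ (ext t)).
have e0 : s *: e i = s *: e i + 0 *: e j by rewrite scale0r addr0.
have := is_derive_line e0 (h2 _ _); rewrite {1}e0 => /(_ (ext 0)).
rewrite pF -[LHS]/('D_(e j) (partial j f) (s *: e i)) => -[_ <-].
have dp : is_derive (0 : R) 1 (fun t => partial i f (n t *: e i))
   (partial i (partial i f) (n 0 *: e i) * (0 / n 0)).
  have h := is_derive1_comp (g := n) (is_derive_partial_ray (rn 0)) (dn 0).
  exact: h.
have dinv : is_derive (0 : R) 1 (fun t => (n t)^-1) (- (n 0) ^- 2 *: (0 / n 0)).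
  by apply: is_deriveV; rewrite gt_eqF.
(* At [t = 0] only the derivative of the factor [t] survives, which gives F'(s) / s. *)
have [_ ->] := is_derive_fM dp (is_derive_fM (is_derive_id (0 : R) 1) dinv erefl) erefl.
by rewrite n0 /= !mul0r !mulr0 add0r addr0 mul1r.
Qed.

Lemma laplacian_ray (s : R) : r < s ->
  laplacian f (s *: delta_mx 0 i) =
  partial i (partial i f) (s *: delta_mx 0 i) +
  (N.-1)%:R * (partial i f (s *: delta_mx 0 i) / s).
Proof.
move=> rs; rewrite /laplacian (bigD1 i)//=; congr (_ + _).
rewrite (eq_bigr (fun=> partial i f (s *: delta_mx 0 i) / s)); last first.
  by move=> j ji; rewrite partial_orthogonal// eq_sym.
by rewrite sumr_const cardC1 card_ord mulr_natl.
Qed.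

End radial.

(** * Boundary behaviour and passage to the autonomous system *)

Lemma dirichlet_ray (R : realType) (N : nat) (f : 'rV[R]_N -> R) (i : 'I_N)
    (r s : R) :
  0 < r -> r < s -> {within closure (exterior r), continuous f} ->
  (forall x, esphere r x -> f x = 0) -> 0 < f (s *: delta_mx 0 i) ->
  exists2 t, r < t < s & f (t *: delta_mx 0 i) < f (s *: delta_mx 0 i).
Proof.
move=> r0 rs fc f0 fs.
pose c (t : R) : 'rV[R]_N := t *: delta_mx 0 i.
have cc : {for r, continuous c} by apply: scalel_continuous.
have near_ext (P : set 'rV[R]_N) : nbhs (c r) P ->
    exists2 t, r < t < s & P (c t).
  move=> hP; have h : \forall t \near r^'+, r < t < s /\ P (c t).
    near=> t; split; first by apply/andP; split; near: t;
      [exact: nbhs_right_gt | exact: nbhs_right_lt].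
    near: t; exact: (cvg_at_right_filter cc hP).
  have [t [ht hPt]] := filter_ex h.
  by exists t.
(* Continuity is relative to the closure of the exterior, so the boundary point must be shown to be
   a limit of exterior points. *)
have rcl : closure (exterior r) (c r).
  move=> U hU; have [t /andP[rt _] Ut] := near_ext U hU.
  by exists (c t); split => //; exact: exterior_ray.
have fl := (subspace_continuousP _ f).1 fc (c r) rcl.
have fcr : f (c r) < f (s *: delta_mx 0 i).
  by rewrite f0// /esphere /= enorm_ray gtr0_norm.
have [t /andP[rt ts] ht] := near_ext _ (fl _ (lt_nbhsl fcr)).
exists t; first by rewrite rt.
by apply: ht; apply: subset_closure; exact: exterior_ray.
Unshelve. all: by end_near. Qed.

(** With rho = e^t and F the profile of [f], a = - rho F', so a' = - rho F' - rho^2 F''; inserting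
    F'' + (N - 1) F' / rho = - g^p / lambda gives w - (N - 2) a. *)
Lemma radial_half_system (R : realType) (N : nat) (lambda p r : R) (i : 'I_N)
    (f g : 'rV[R]_N -> R) :
  (0 < N)%N -> 0 < lambda -> 0 < r ->
  C2_on (exterior r) f -> radial_on (exterior r) f ->
  (forall x, exterior r x -> 0 < f x /\ 0 < g x) ->
  (forall x, exterior r x -> lambda * laplacian f x + g x `^ p = 0) ->
  half_system (ln r) (N%:R - 2) (fun t => f (expR t *: delta_mx 0 i))
    (fun t => - (expR t * partial i f (expR t *: delta_mx 0 i)))
    (fun t => lambda^-1 * (expR (2 * t) * g (expR t *: delta_mx 0 i) `^ p)).
Proof.
move=> N0 l0 r0 f2 fr pos feq t rt.
have re : r < expR t by rewrite -(lnK r0) ltr_expR.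
have ext := exterior_ray (i := i) r0 re.
have [fp gp] := pos _ ext.
have df := is_derive1_comp (is_derive_ray i r0 f2 re) (is_derive_expR t).
have dp := is_derive1_comp (is_derive_partial_ray i r0 f2 re) (is_derive_expR t).
split => //.
- by rewrite !mulr_gt0 ?invr_gt0 ?expR_gt0 ?powR_gt0.
- by apply: is_derive_eq df _; rewrite opprK mulrC.
have -> : (fun s => - (expR s * partial i f (expR s *: delta_mx 0 i))) =
    (fun s => (-1) * (expR s * partial i f (expR s *: delta_mx 0 i))).
  by apply/funext => s; rewrite mulN1r.
apply: is_derive_fZ (is_derive_fM (is_derive_expR t) dp erefl) _.
have := feq _ ext; rewrite (laplacian_ray i r0 f2 fr re).
have -> : N.-1%:R = N%:R - 1 :> R by rewrite -[in RHS](prednK N0) -natr1 addrK.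
move=> /eqP; rewrite addr_eq0 => /eqP h.
have -> : g (expR t *: delta_mx 0 i) `^ p = - - g (expR t *: delta_mx 0 i) `^ p.
  by rewrite opprK.
rewrite -h mulr_natl mulr2n expRD /=; field.
by rewrite !gt_eqF ?expR_gt0.
Qed.

Lemma radial_power_source (R : realType) (N : nat) (lambda p r : R) (i : 'I_N)
    (g : 'rV[R]_N -> R) :
  0 < lambda -> 0 < p -> 0 < r ->
  C2_on (exterior r) g -> (forall x, exterior r x -> 0 < g x) ->
  power_source (ln r) (- ln lambda) p (fun t => g (expR t *: delta_mx 0 i))
    (fun t => - (expR t * partial i g (expR t *: delta_mx 0 i)))
    (fun t => lambda^-1 * (expR (2 * t) * g (expR t *: delta_mx 0 i) `^ p)).
Proof.
move=> l0 p0 r0 g2 pos t rt.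
have re : r < expR t by rewrite -(lnK r0) ltr_expR.
have ext := exterior_ray (i := i) r0 re.
have gp := pos _ ext.
have dg := is_derive1_comp (is_derive_ray i r0 g2 re) (is_derive_expR t).
split; last first.
  rewrite !lnM ?posrE ?mulr_gt0 ?invr_gt0 ?expR_gt0 ?powR_gt0//.
  by rewrite lnV ?posrE// expRK ln_powR addrA.
have dpow := is_derive1_comp (f := fun x : R => x `^ p)
  (is_derive1_powR p gp) dg.
apply: is_derive_fZ (is_derive_fM (is_derive_expRZ 2 t) dpow erefl) _.
rewrite /= -(mulr_powRB1 (ltW gp) p0).
by field; rewrite !gt_eqF.
Qed.

(** Near the boundary the profile is smaller than at [ln r + 1], so the mean value theorem gives a
    point of positive slope. *)
Lemma dirichlet_increasing (R : realType) (N : nat) (f : 'rV[R]_N -> R)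
    (i : 'I_N) (r nu : R) (w : R -> R) :
  0 < r -> {within closure (exterior r), continuous f} ->
  (forall x, esphere r x -> f x = 0) ->
  half_system (ln r) nu (fun t => f (expR t *: delta_mx 0 i))
    (fun t => - (expR t * partial i f (expR t *: delta_mx 0 i))) w ->
  exists2 s, ln r < s & - (expR s * partial i f (expR s *: delta_mx 0 i)) < 0.
Proof.
move=> r0 fc f0 hs.
have T1 : ln r < ln r + 1 by lra.
have [f1 _ _ _] := hs _ T1.
have re : r < expR (ln r + 1) by rewrite -[ltLHS](lnK r0) ltr_expR.
have [t /andP[rt tr] ft] := dirichlet_ray r0 re fc f0 f1.
have t0 : 0 < t by apply: lt_trans rt.
have Tt : ln r < ln t by rewrite ltr_ln.
have tT : ln t < ln r + 1 by rewrite -ltr_expR lnK.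
have hf x : ln r < x -> is_derive x 1 (fun t => f (expR t *: delta_mx 0 i))
    (- - (expR x * partial i f (expR x *: delta_mx 0 i))) by move=> /hs[].
have [c /andP[tc _] e] := ray_MVT hf Tt tT.
exists c; first exact: lt_trans tc.
move: ft; rewrite -{1}(lnK t0) -subr_gt0.
by rewrite e pmulr_lgt0 ?subr_gt0// oppr_gt0.
Qed.

Theorem theorem1p9 (R : realType) (N : nat) (lambda p q alpha beta : R)
  (hN : (3 <= N)%N)
  (hlambda : 0 < lambda)
  (hp : 0 < p) (hq : 0 < q) (hpq : 1 < p * q)
  (halpha : alpha = 2 * (p + 1) / (p * q - 1))
  (hbeta : beta = 2 * (q + 1) / (p * q - 1))
  (hab : N%:R - 2 <= alpha + beta) :
  forall r : R, 0 < r ->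
  ~ exists u v : 'rV[R]_N -> R, radial_positive_solution lambda p q r u v.
Proof.
move=> r r0 [u [v [[u2 uc] [v2 vc] ur vr equ eqv pos bd]]].
have N0 : (0 < N)%N by apply: leq_trans hN.
pose i := Ordinal N0.
have pos' x : exterior r x -> 0 < v x /\ 0 < u x by move=> /pos[].
have hu := radial_half_system i N0 hlambda r0 u2 ur pos equ.
have hv := radial_half_system i N0 hlambda r0 v2 vr pos' eqv.
have hw := radial_power_source i hlambda hp r0 v2 (fun x hx => (pos x hx).2).
have hz := radial_power_source i hlambda hq r0 u2 (fun x hx => (pos x hx).1).
have nu0 : 0 < N%:R - 2 :> R by rewrite subr_gt0 ltr_nat.
apply: (lane_emden_system_nonexistence nu0 hp hq hpq halpha hbeta hab
  (And4 hu hv hw hz)).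
have [s1 Ts1 hs1] := dirichlet_increasing r0 uc (fun x hx => (bd x hx).1) hu.
have [s2 Ts2 hs2] := dirichlet_increasing r0 vc (fun x hx => (bd x hx).2) hv.
(* Negativity propagates backward by [half_system_lt0], so both signs hold at the smaller point. *)
exists (Num.min s1 s2); first by rewrite lt_min Ts1.
have Ts : ln r < Num.min s1 s2 by rewrite lt_min Ts1.
split.
  by apply: half_system_lt0 hu Ts _ hs1; rewrite ge_min lexx.
by apply: half_system_lt0 hv Ts _ hs2; rewrite ge_min lexx orbT.
Qed.
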